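(* Let $n\ge 4$ be even and let $L$ be an $n$-dimensional complex non-strongly nilpotent filiform Leibniz algebra from the family $F_2(\beta_4,\dots,\beta_n,\gamma)$. Then $L$ is isomorphic to one of the following algebras: (a) $F_2^{2s}(0,\dots,0,\beta_{2s},0,\dots,0,\beta_{n-1},\beta_n,\gamma)$ with $\beta_{2s}=1$, for some $2\le s\le\frac{n-2}{2}$; that is, an algebra $F_2(\beta_4,\dots,\beta_n,\gamma)$ with $\beta_{2s}=1$, $\beta_j=0$ for all $4\le j\le n-2$ with $j\ne 2s$, and $\beta_{n-1},\beta_n,\gamma\in\mathbb{C}$ arbitrary; (b) $F_2(0,\beta_5,0,\beta_7,0,\dots,0,\beta_{n-1},\beta_n,\gamma)$; that is, an algebra $F_2(\beta_4,\dots,\beta_n,\gamma)$ with $\beta_{2i}=0$ for all $2\le i\le\frac{n-2}{2}$ and the remaining parameters arbitrary in $\mathbb{C}$.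
   Context: A (right) Leibniz algebra is a vector space $L$ with a bilinear bracket satisfying $[[x,y],z]=[[x,z],y]+[x,[y,z]]$ for all $x,y,z\in L$. A pre-derivation of $L$ is a linear map $P:L\to L$ with $P([[x,y],z])=[[P(x),y],z]+[[x,P(y)],z]+[[x,y],P(z)]$ for all $x,y,z\in L$. A Leibniz algebra is strongly nilpotent if every pre-derivation of it is a nilpotent linear map; otherwise it is non-strongly nilpotent. For $\beta_4,\dots,\beta_n,\gamma\in\mathbb{C}$, $F_2(\beta_4,\dots,\beta_n,\gamma)$ is the $n$-dimensional complex (filiform) Leibniz algebra with basis $e_1,\dots,e_n$ and products $[e_1,e_1]=e_3$; $[e_i,e_1]=e_{i+1}$ for $3\le i\le n-1$; $[e_1,e_2]=\sum_{t=4}^{n}\beta_te_t$; $[e_2,e_2]=\gamma e_n$; $[e_j,e_2]=\sum_{t=j+2}^{n}\beta_{t-j+2}e_t$ for $3\le j\le n-2$; all omitted products of basis elements are zero. The superscript in $F_2^{2s}$ only records the position of the nonzero parameter. *)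

(* Defs.v *)
From HB Require Import structures.
From mathcomp Require Import all_boot all_order all_algebra.
From mathcomp Require Import zify.

Set Implicit Arguments.
Unset Strict Implicit.
Unset Printing Implicit Defensive.

Import GRing.Theory.
Local Open Scope ring_scope.

HB.mixin Record Vector_isLeibniz (K : fieldType) L of Vector K L := {
  lbr : L -> L -> L;
  lbr_linearl : forall (a : K) (x x' y : L),
    lbr (a *: x + x') y = a *: lbr x y + lbr x' y;
  lbr_linearr : forall (a : K) (x y y' : L),
    lbr x (a *: y + y') = a *: lbr x y + lbr x y';
  lbr_leibniz : forall x y z : L,
    lbr (lbr x y) z = lbr (lbr x z) y + lbr x (lbr y z)
}.

(* Finite-dimensional right Leibniz algebras over K. *)
#[short(type="leibnizType")]
HB.structure Definition Leibniz (K : fieldType) :=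
  {L of Vector_isLeibniz K L & Vector K L}.

Definition leibniz_isomorphic (K : fieldType) (L M : leibnizType K) : Prop :=
  exists f : 'Hom(L, M),
    bijective f /\ forall x y : L, f (lbr x y) = lbr (f x) (f y).

Definition pre_derivation (K : fieldType) (L : leibnizType K)
    (P : 'End(L)) : Prop :=
  forall x y z : L,
    P (lbr (lbr x y) z) =
      lbr (lbr (P x) y) z + lbr (lbr x (P y)) z + lbr (lbr x y) (P z).

Definition nilpotent_endo (K : fieldType) (V : vectType K)
    (P : 'End(V)) : Prop :=
  exists k : nat, forall x : V, iter k P x = 0.

Definition strongly_nilpotent (K : fieldType) (L : leibnizType K) : Prop :=
  forall P : 'End(L), pre_derivation P -> nilpotent_endo P.

Section F2Bracket.
Variables (K : fieldType) (n : nat) (beta : nat -> K) (gamma : K).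

(* Basis vectors are numbered from 1: e_i is the (i - 1)-th vector of the
   canonical basis, and [F2_basis i = 0] when i is not in 1..n. *)
Definition F2_basis (i : nat) : 'rV[K]_n := \row_(j < n) (j.+1 == i)%:R.

Definition F2_mul (i j : nat) : 'rV[K]_n :=
  if (i == 1) && (j == 1) then F2_basis 3
  else if (3 <= i <= n - 1)%N && (j == 1) then F2_basis i.+1
  else if (i == 1) && (j == 2) then
    \sum_(4 <= t < n.+1) beta t *: F2_basis t
  else if (i == 2) && (j == 2) then gamma *: F2_basis n
  else if (3 <= i <= n - 2)%N && (j == 2) then
    \sum_(i + 2 <= t < n.+1) beta (t - i + 2)%N *: F2_basis t
  else 0.

Definition F2_br (x y : 'rV[K]_n) : 'rV[K]_n :=
  \sum_(i < n) \sum_(j < n) (x 0 i * y 0 j) *: F2_mul i.+1 j.+1.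

Lemma F2_br_linearl a x x' y : F2_br (a *: x + x') y = a *: F2_br x y + F2_br x' y.
Proof.
rewrite /F2_br scaler_sumr -big_split; apply: eq_bigr => i _ /=.
rewrite scaler_sumr -big_split; apply: eq_bigr => j _ /=.
by rewrite !mxE mulrDl scalerDl scalerA mulrA.
Qed.

Lemma F2_br_linearr a x y y' : F2_br x (a *: y + y') = a *: F2_br x y + F2_br x y'.
Proof.
rewrite /F2_br scaler_sumr -big_split; apply: eq_bigr => i _ /=.
rewrite scaler_sumr -big_split; apply: eq_bigr => j _ /=.
by rewrite !mxE mulrDr scalerDl scalerA mulrCA.
Qed.

Let F2_brr y x := F2_br x y.

HB.instance Definition _ (y : 'rV[K]_n) :=
  GRing.isLinear.Build K 'rV[K]_n 'rV[K]_n *:%R (F2_brr y)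
    (fun a x x' => F2_br_linearl a x x' y).
HB.instance Definition _ (x : 'rV[K]_n) :=
  GRing.isLinear.Build K 'rV[K]_n 'rV[K]_n *:%R (F2_br x)
    (fun a y y' => F2_br_linearr a x y y').

Lemma F2_basis_out i : (n < i)%N -> F2_basis i = 0.
Proof.
move=> ni; apply/rowP => j; rewrite !mxE; case: eqP => // ji.
by move: ni; rewrite -ji ltnNge ltn_ord.
Qed.

Lemma F2_br_basis i j : (0 < i <= n)%N -> (0 < j <= n)%N ->
  F2_br (F2_basis i) (F2_basis j) = F2_mul i j.
Proof.
case: i j => [//|i] [//|j] /= hi hj.
rewrite /F2_br (bigD1 (Ordinal hi)) //= (bigD1 (Ordinal hj)) //=.
rewrite !mxE !eqxx mulr1 scale1r !big1 ?addr0 // => [i' ne|j' ne].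
  rewrite big1 // => j' _; rewrite !mxE eqSS.
  by move: ne; rewrite -val_eqE /= => /negPf ->; rewrite mul0r scale0r.
by rewrite !mxE !eqSS; move: ne; rewrite -val_eqE /= => /negPf ->; rewrite mulr0 scale0r.
Qed.

Lemma F2_basis_sum (x : 'rV[K]_n) : x = \sum_(i < n) x 0 i *: F2_basis i.+1.
Proof.
apply/rowP => j; rewrite summxE (bigD1 j) //= !mxE eqxx mulr1 big1 ?addr0 // => i ne.
by rewrite !mxE eqSS eq_sym; move: ne; rewrite -val_eqE => /negPf ->; rewrite mulr0.
Qed.

Definition F2_tail (z : 'rV[K]_n) := forall i : 'I_n, (i < 2)%N -> z 0 i = 0.

Lemma F2_basis_tail t : (3 <= t)%N -> F2_tail (F2_basis t).
Proof.
by move=> t3 i i2; rewrite mxE; case: eqP => // it; move: t3; rewrite -it ltnNge i2.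
Qed.

Lemma F2_tailZ a z : F2_tail z -> F2_tail (a *: z).
Proof. by move=> hz i i2; rewrite mxE hz // mulr0. Qed.

Lemma F2_tail_sum I (r : seq I) (P : pred I) (F : I -> 'rV[K]_n) :
  (forall i, P i -> F2_tail (F i)) -> F2_tail (\sum_(i <- r | P i) F i).
Proof. by move=> h j j2; rewrite summxE big1 // => i Pi; apply: h. Qed.

Lemma F2_mul_tail i j : (3 <= n)%N -> F2_tail (F2_mul i j).
Proof.
move=> n3; rewrite /F2_mul.
case: ifP => _; first exact: F2_basis_tail.
case: ifP => [/andP[/andP[i3 _] _]|_].
  by apply: F2_basis_tail; apply: ltnW.
case: ifP => _.
  rewrite big_nat; apply: F2_tail_sum => t /andP[t4 _].
  by apply: F2_tailZ; apply: F2_basis_tail; apply: ltnW.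
case: ifP => _; first by apply: F2_tailZ; apply: F2_basis_tail.
case: ifP => [/andP[/andP[i3 _] _]|_]; last by move=> k _; rewrite mxE.
rewrite big_nat; apply: F2_tail_sum => t /andP[ti _].
apply: F2_tailZ; apply: F2_basis_tail; apply: leq_trans ti.
exact: leq_trans (leq_addr _ _).
Qed.

Lemma F2_br_tail x y : (3 <= n)%N -> F2_tail (F2_br x y).
Proof.
move=> n3; apply: F2_tail_sum => i _; apply: F2_tail_sum => j _.
by apply: F2_tailZ; apply: F2_mul_tail.
Qed.

Lemma F2_mulr0 i j : (3 <= j)%N -> F2_mul i j = 0.
Proof. by case: j => [|[|[|j]]] // _; rewrite /F2_mul !andbF. Qed.

Lemma F2_br_tailr x z : F2_tail z -> F2_br x z = 0.
Proof.
move=> hz; rewrite /F2_br big1 // => i _; rewrite big1 // => j _.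
case: (ltnP j 2) => j2; first by rewrite hz // mulr0 scale0r.
by rewrite F2_mulr0 // scaler0.
Qed.

Lemma F2_mul_ge3_1 i : (3 <= n)%N -> (3 <= i)%N -> F2_mul i 1 = F2_basis i.+1.
Proof.
case: i => [|[|[|i]]] // n3 _; rewrite /F2_mul /= !andbT !andbF.
by case: ifP => // /negbT; rewrite -ltnNge => h; rewrite F2_basis_out //; lia.
Qed.

Lemma F2_mul_ge3_2 i : (3 <= n)%N -> (3 <= i)%N ->
  F2_mul i 2 = \sum_(i + 2 <= t < n.+1) beta (t - i + 2)%N *: F2_basis t.
Proof.
case: i => [|[|[|i]]] // n3 _; rewrite /F2_mul /= !andbT !andbF.
by case: ifP => // /negbT; rewrite -ltnNge => h; rewrite big_geq //; lia.
Qed.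

Lemma F2_br_ge3 t j : (3 <= n)%N -> (3 <= t)%N -> (j == 1) || (j == 2) ->
  F2_br (F2_basis t) (F2_basis j) = F2_mul t j.
Proof.
move=> n3 t3 hj; case: (leqP t n) => tn.
  by apply: F2_br_basis; first (by lia); case/orP: hj => /eqP ->; lia.
rewrite F2_basis_out // -/(F2_brr _ _) linear0.
case/orP: hj => /eqP ->.
  by rewrite F2_mul_ge3_1 // F2_basis_out //; lia.
by rewrite F2_mul_ge3_2 // big_geq //; lia.
Qed.

Lemma F2_br_shift m (c : nat -> K) : (3 <= n)%N -> (3 <= m)%N ->
  F2_br (\sum_(m <= t < n.+1) c t *: F2_basis t) (F2_basis 1) =
  \sum_(m.+1 <= t < n.+1) c t.-1 *: F2_basis t.
Proof.
move=> n3 m3; rewrite -/(F2_brr _ _) linear_sum /=.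
under eq_big_nat => t /andP[mt tn].
  rewrite linearZ_LR /= /F2_brr F2_br_ge3 // ?(leq_trans m3) //.
  rewrite F2_mul_ge3_1 // ?(leq_trans m3) //.
  over.
case: (leqP m n) => mn; last by rewrite !big_geq //; lia.
by rewrite big_nat_recr //= F2_basis_out // scaler0 addr0 [RHS]big_add1.
Qed.

Lemma F2_mul_comm i : (3 <= n)%N -> (0 < i <= n)%N ->
  F2_br (F2_mul i 1) (F2_basis 2) = F2_br (F2_mul i 2) (F2_basis 1).
Proof.
move=> n3; case: i => [|[|[|i]]] // hi.
- have -> : F2_mul 1 1 = F2_basis 3 by [].
  have -> : F2_mul 1 2 = \sum_(4 <= t < n.+1) beta t *: F2_basis t by [].
  rewrite F2_br_shift // F2_br_ge3 // F2_mul_ge3_2 //.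
  by apply: eq_big_nat => t /andP[t5 _]; congr (beta _ *: _); lia.
- have -> : F2_mul 2 1 = 0 by [].
  have -> : F2_mul 2 2 = gamma *: F2_basis n by [].
  rewrite -/(F2_brr _ _) linear0 -/(F2_brr _ _) linearZ_LR /= /F2_brr.
  by rewrite F2_br_ge3 // F2_mul_ge3_1 // F2_basis_out // scaler0.
- rewrite F2_mul_ge3_1 // F2_br_ge3 // !F2_mul_ge3_2 // F2_br_shift //.
  by apply: eq_big_nat => t /andP[t5 _]; congr (beta _ *: _); lia.
Qed.

Lemma F2_br_expandl x y : F2_br x y = \sum_(i < n) x 0 i *: F2_br (F2_basis i.+1) y.
Proof.
rewrite {1}[x]F2_basis_sum -/(F2_brr _ _) linear_sum /=.
by apply: eq_bigr => i _; rewrite linearZ_LR.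
Qed.

Lemma F2_br_expandr x y : F2_br x y = \sum_(i < n) y 0 i *: F2_br x (F2_basis i.+1).
Proof.
rewrite {1}[y]F2_basis_sum linear_sum /=.
by apply: eq_bigr => i _; rewrite linearZ_LR.
Qed.

Lemma F2_br_suml I (r : seq I) (c : I -> K) (u : I -> 'rV[K]_n) y :
  F2_br (\sum_(i <- r) c i *: u i) y = \sum_(i <- r) c i *: F2_br (u i) y.
Proof.
rewrite -/(F2_brr _ _) linear_sum /=.
by apply: eq_bigr => i _; rewrite linearZ_LR.
Qed.

Lemma F2_br_comm x y z : (3 <= n)%N ->
  F2_br (F2_br x y) z = F2_br (F2_br x z) y.
Proof.
move=> n3.
rewrite (F2_br_expandl x y) (F2_br_expandl x z) !F2_br_suml.
apply: eq_bigr => i _; congr (_ *: _); set e := F2_basis i.+1.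
rewrite (F2_br_expandr e y) F2_br_suml (F2_br_expandr (F2_br e z) y).
apply: eq_bigr => j _; congr (_ *: _).
rewrite (F2_br_expandr e z) F2_br_suml F2_br_expandr.
apply: eq_bigr => k _; congr (_ *: _).
have tail0 m u : F2_br u (F2_basis m.+3) = 0 by apply/F2_br_tailr/F2_basis_tail.
have br0 u : F2_br 0 u = 0 by rewrite -/(F2_brr u 0) linear0.
have n1 : (0 < 1 <= n)%N by lia.
have n2 : (0 < 2 <= n)%N by lia.
have hi : (0 < i.+1 <= n)%N by rewrite ltn_ord.
case: j k => [[|[|j]] jn] [[|[|k]] kn] //=; rewrite ?tail0 ?br0 //.
- by rewrite !F2_br_basis // F2_mul_comm.
- by rewrite !F2_br_basis // F2_mul_comm.
Qed.

Lemma F2_br_leibniz x y z : (3 <= n)%N ->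
  F2_br (F2_br x y) z = F2_br (F2_br x z) y + F2_br x (F2_br y z).
Proof.
move=> n3; rewrite [F2_br x (F2_br y z)]F2_br_tailr ?addr0; last exact: F2_br_tail.
exact: F2_br_comm.
Qed.

End F2Bracket.

(* The carrier depends on a proof of 4 <= n because [F2_br] is not a Leibniz
   bracket for n = 2 (where e_n = e_2).  Only the values beta 4, ..., beta n of
   the sequence beta are used. *)
Definition F2 (K : fieldType) (n : nat) (n4 : (4 <= n)%N) (beta : nat -> K)
  (gamma : K) : Type := 'rV[K]_n.

HB.instance Definition _ (K : fieldType) (n : nat) (n4 : (4 <= n)%N)
  (beta : nat -> K) (gamma : K) := Vector.on (F2 n4 beta gamma).

HB.instance Definition _ (K : fieldType) (n : nat) (n4 : (4 <= n)%N)
    (beta : nat -> K) (gamma : K) :=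
  Vector_isLeibniz.Build K (F2 n4 beta gamma)
    (F2_br_linearl beta gamma) (F2_br_linearr beta gamma)
    (fun x y z => F2_br_leibniz beta gamma x y z (ltnW n4)).

Lemma F2_dim (K : fieldType) (n : nat) (n4 : (4 <= n)%N) (beta : nat -> K)
  (gamma : K) : \dim {: F2 n4 beta gamma} = n.
Proof. by rewrite dimvf /dim /= mul1n. Qed.

Lemma F2_lbr_basis (K : fieldType) (n : nat) (n4 : (4 <= n)%N)
    (beta : nat -> K) (gamma : K) (i j : nat) :
    (0 < i <= n)%N -> (0 < j <= n)%N ->
  lbr (F2_basis K n i : F2 n4 beta gamma) (F2_basis K n j)
    = F2_mul n beta gamma i j.
Proof. exact: F2_br_basis. Qed.

(* Main.v *)
(* Write M for the span of e_1, e_3, ..., e_n, identified with K[X]/(X^(n-1)) by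
   e_1 = 1 and e_t = X^(t-2) for t >= 3.  Right multiplication by e_1 is then
   multiplication by X on M, and right multiplication by e_2 is multiplication
   by B = sum_t beta_t X^(t-2); the only nonzero product [e_2, x] comes from
   [e_2, e_2] = gamma X^(n-2).

   A pre-derivation P with P e_1 = p e_1 + c e_2 + ... acts on M like the vector
   field (pX + cB) d/dX plus a multiplication, up to an error that is linear over
   the polynomials in X^2 because the defining identity only involves triple
   products.  Comparing two expressions of P(x.e_1.e_2), the error w = w_1 X + ...
   must satisfy X B_even w = 0, and (pX + cB) B' = qB modulo X^(n-3).
   If p = 0 and w_1 <> 0, then the even part of B vanishes modulo X^(n-3); if
   p = 0 and w_1 = 0, then P is nilpotent.  If p <> 0, then B is an eigenvector of
   the vector field, hence a multiple of y^k modulo X^(n-3) in the linearizing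
   coordinate y = X + tB.  Replacing e_1 by e_1 + t e_2, which acts as y, and
   rescaling e_2 turns B into y^k. *)
Require Import Defs.
From HB Require Import structures.
From mathcomp Require Import all_boot all_order all_algebra.
From mathcomp Require Import reals complex.
From mathcomp Require Import boolp ring zify.

Set Implicit Arguments.
Unset Strict Implicit.
Unset Printing Implicit Defensive.

Import GRing.Theory Num.Theory.
Local Open Scope ring_scope.

(** * Congruences of polynomials modulo a power of X *)

Section ModX.
Variable K : numFieldType.
Implicit Types f g h v : {poly K}.

(** The explicit quotient h turns congruences into equations, so that goals reduce to [ring]
    identities. *)
Definition modX N f g := exists h, f = g + 'X^N * h.

Lemma modX_coefP N f g :
  modX N f g <-> forall i, (i < N)%N -> f`_i = g`_i.
Proof.
split=> [[h ->] i iN|e]; first by rewrite coefD coefXnM iN addr0.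
exists (drop_poly N (f - g)).
rewrite -[LHS](subrK g) addrC; congr (_ + _).
rewrite -{1}(poly_take_drop N (f - g)) mulrC -[RHS]add0r; congr (_ + _).
by apply/polyP => i; rewrite coef_take_poly coef0 coefB; case: ifP => // /e ->; rewrite subrr.
Qed.

Lemma modX_cancel N k f g : modX (k + N) ('X^k * f) ('X^k * g) -> modX N f g.
Proof.
case=> h; rewrite exprD -mulrA -mulrDr => e; exists h.
by apply: mulfI e; rewrite monic_neq0 // monicXn.
Qed.

Lemma modX_le M N f g : (M <= N)%N -> modX N f g -> modX M f g.
Proof. by move=> MN [h ->]; exists ('X^(N - M) * h); rewrite mulrA -exprD subnKC. Qed.

Lemma modX_comp N f g v : modX N f g -> modX N (f \Po ('X * v)) (g \Po ('X * v)).
Proof.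
case=> h ->; exists (v ^+ N * (h \Po ('X * v))).
by rewrite comp_polyD comp_polyM comp_Xn_poly exprMn mulrA.
Qed.

Lemma modX1 f : modX 1 f (f`_0)%:P.
Proof. by apply/modX_coefP => -[|i] // _; rewrite coefC. Qed.

Lemma coef0_comp f v : (f \Po ('X * v))`_0 = f`_0.
Proof. by rewrite -!horner_coef0 horner_comp hornerM hornerX mul0r. Qed.

(** As v^N has constant term 1, the substitution sends c X^N + ... to c X^N + ... and so preserves
    the order of vanishing. *)
Lemma modX_comp_inj N f v :
  v`_0 = 1 -> modX N (f \Po ('X * v)) 0 -> modX N f 0.
Proof.
move=> v0; elim: N => [|N IH] fN; first by exists f; rewrite add0r mul1r.
have [h def_f] := IH (modX_le (leqnSn N) fN).
case: fN => k; rewrite def_f !add0r comp_polyM comp_Xn_poly exprMn -mulrA exprSr -mulrA.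
move/mulfI; rewrite monic_neq0 ?monicXn // => /(_ isT).
move/(congr1 (fun p : {poly K} => p`_0)); rewrite coefXM /= coef0M coef0_comp.
rewrite -horner_coef0 horner_exp horner_coef0 v0 expr1n mul1r => h0.
have [h' ->] := modX1 h; exists h'.
by rewrite h0 polyC0 !add0r expr1 exprSr mulrA.
Qed.

(** Successive approximation: if the error is X^N k, subtracting k_0 X^N from g corrects degree N
    and disturbs no lower degree. *)
Lemma modX_comp_surj N h v :
  v`_0 = 1 -> exists g, modX N (g \Po ('X * v)) h.
Proof.
move=> v0; elim: N => [|N [g [k def_g]]].
  by exists 0; exists (0 - h); rewrite comp_poly0 mul1r addrC subrK.
have [k' ] := modX1 k; move: (k`_0) => c def_k.
have [v' def_v] := modX1 (v ^+ N).
have vN0 : (v ^+ N)`_0 = 1.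
  by rewrite -horner_coef0 horner_exp horner_coef0 v0 expr1n.
rewrite vN0 in def_v.
exists (g - c%:P * 'X^N); exists (k' - c%:P * v').
rewrite comp_polyB comp_polyM comp_Xn_poly comp_polyC exprMn def_v def_g def_k.
by rewrite (exprSr _ N) polyC1 expr1; ring.
Qed.

Lemma modX_mulr_inj N f v : v`_0 != 0 -> modX N (f * v) 0 -> modX N f 0.
Proof.
move=> v0; elim: N => [|N IH] fN; first by exists f; rewrite add0r mul1r.
have [h def_f] := IH (modX_le (leqnSn N) fN).
case: fN => k; rewrite def_f !add0r exprSr -!mulrA => /mulfI.
rewrite monic_neq0 ?monicXn // => /(_ isT) /(congr1 (fun p : {poly K} => p`_0)).
rewrite coefXM /= coef0M => /eqP; rewrite mulf_eq0 (negPf v0) orbF => /eqP h0.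
have [h' ->] := modX1 h; exists h'.
by rewrite h0 polyC0 !add0r expr1 exprSr mulrA.
Qed.

End ModX.

(** * The algebra as e_2 together with truncated polynomials *)

Section PolyModel.
Variables (K : numFieldType) (m : nat).
Notation n := m.+4.

(* The vector a e_2 + f; only the residue of f modulo X^(n-1) matters. *)
Definition mk (a : K) (f : {poly K}) : 'rV[K]_n :=
  \row_j (if j == 0 :> nat then f`_0 else if j == 1 :> nat then a else f`_j.-1).

Definition coef2 (v : 'rV[K]_n) : K := v 0 1.

(** For i > 0, degree i corresponds to e_(i+2), stored at 0-based index i+1; index 1, the slot of
    e_2, is skipped. *)
Definition polyp (v : 'rV[K]_n) : {poly K} :=
  \poly_(i < m.+3) v 0 (inord (if i == 0 then 0 else i.+1)%N).

Lemma mkK v : mk (coef2 v) (polyp v) = v.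
Proof.
apply/rowP => j; rewrite mxE !coef_poly /=.
case: j => [[|[|j]] jn] /=; rewrite ?(ltnW jn).
- by congr (v 0 _); apply/val_inj; rewrite /= inordK.
- by congr (v 0 _); apply/val_inj.
- have -> : (j.+1 < m.+3)%N by [].
  by congr (v 0 _); apply/val_inj; rewrite /= inordK.
Qed.

Lemma coef2_mk a f : coef2 (mk a f) = a.
Proof. by rewrite /coef2 mxE. Qed.

Lemma coef_polyp_mk a f i : (i < m.+3)%N -> (polyp (mk a f))`_i = f`_i.
Proof.
move=> im; rewrite coef_poly im mxE; case: i im => [|i] im.
  by rewrite inordK.
by rewrite inordK.
Qed.

Lemma mk_lin k a f b g : k *: mk a f + mk b g = mk (k * a + b) (k *: f + g).
Proof.
apply/rowP => j; rewrite !mxE.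
by case: ifP => _; [|case: ifP => _]; rewrite ?coefD ?coefZ.
Qed.

Lemma mkZ k a f : k *: mk a f = mk (k * a) (k *: f).
Proof. by apply/rowP => j; rewrite !mxE; case: ifP => _; [|case: ifP => _]; rewrite ?coefZ. Qed.

Lemma mkD a f b g : mk a f + mk b g = mk (a + b) (f + g).
Proof. by apply/rowP => j; rewrite !mxE; case: ifP => _; [|case: ifP => _]; rewrite ?coefD. Qed.

Lemma mk0 : mk 0 0 = 0.
Proof. by apply/rowP => j; rewrite !mxE !coef0; case: ifP => _; [|case: ifP => _]. Qed.

Lemma mk_sum I (r : seq I) (P : pred I) (F : I -> {poly K}) :
  \sum_(i <- r | P i) mk 0 (F i) = mk 0 (\sum_(i <- r | P i) F i).
Proof.
by elim/big_rec2: _ => [|i y x _ ->]; rewrite ?mk0 // mkD addr0.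
Qed.

Lemma mk_modX a f g : modX m.+3 f g -> mk a f = mk a g.
Proof.
move=> /modX_coefP e; apply/rowP => -[[|[|j]] jn]; rewrite !mxE //=; exact: e.
Qed.

Lemma mk_inj a f b g : mk a f = mk b g -> a = b /\ modX m.+3 f g.
Proof.
move=> e; split; first by rewrite -(coef2_mk a f) e coef2_mk.
by apply/modX_coefP => i im; rewrite -(coef_polyp_mk a f im) e coef_polyp_mk.
Qed.

Lemma polyp_mk a f : modX m.+3 (polyp (mk a f)) f.
Proof. by apply/modX_coefP => i; apply: coef_polyp_mk. Qed.

Lemma basis_mk t : (3 <= t)%N -> F2_basis K n t = mk 0 'X^(t - 2).
Proof.
move=> t3; apply/rowP => -[[|[|j]] jn]; rewrite !mxE !coefXn /=.
- by case: t t3 => [|[|[|t]]].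
- by case: t t3 => [|[|[|t]]].
- by rewrite (_ : (_ == t)%N = (j.+1 == t - 2)%N) //; lia.
Qed.

Definition beta_poly (beta : nat -> K) : {poly K} :=
  \poly_(i < m.+3) (if (2 <= i)%N then beta i.+2 else 0).

Lemma coef_sum_Xn (c : nat -> K) a i : (2 <= a)%N -> (i < m.+3)%N ->
  (\sum_(a <= t < n.+1) c t *: 'X^(t - 2))`_i = if (a <= i.+2)%N then c i.+2 else 0.
Proof.
move=> a2 im; rewrite coef_sum.
case: ifP => ai.
  rewrite (bigD1_seq i.+2) ?iota_uniq //=; last by rewrite mem_index_iota; lia.
  rewrite coefZ coefXn (_ : (i == _)%N) ?mulr1; last by lia.
  rewrite big_nat_cond big1 ?addr0 // => t /andP[h ti].
  by rewrite coefZ coefXn (_ : (i == _)%N = false) ?mulr0 //; lia.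
rewrite big_nat big1 // => t h.
by rewrite coefZ coefXn (_ : (i == _)%N = false) ?mulr0 //; lia.
Qed.

Lemma sum_basis_mk (c : nat -> K) a : (3 <= a)%N ->
  \sum_(a <= t < n.+1) c t *: F2_basis K n t =
  mk 0 (\sum_(a <= t < n.+1) c t *: 'X^(t - 2)).
Proof.
move=> a3; rewrite -mk_sum big_nat [RHS]big_nat; apply: eq_bigr => t h.
by rewrite basis_mk ?mkZ ?mulr0 //; lia.
Qed.

Variables (beta : nat -> K) (gamma : K).
Notation B := (beta_poly beta).
Notation mul := (F2_mul n beta gamma).
Notation br := (F2_br beta gamma).

Lemma mul_1 i : mul i.+3 1 = mk 0 ('X^(i.+1) * 'X).
Proof. by rewrite F2_mul_ge3_1 // basis_mk // -exprSr. Qed.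

Lemma mul_2 i : mul i.+3 2 = mk 0 ('X^(i.+1) * B).
Proof.
rewrite F2_mul_ge3_2 // sum_basis_mk; last by lia.
apply/mk_modX/modX_coefP => j jm.
rewrite (@coef_sum_Xn (fun t => beta (t - i.+3 + 2)%N)) // coefXnM.
rewrite coef_poly; case: (ltnP j i.+1) => ji; first by rewrite ifF //; lia.
rewrite (_ : (j - i.+1 < m.+3)%N); last by lia.
by case: ifP; case: ifP => //; [move=> *; congr (beta _); lia | lia | lia].
Qed.

Lemma br_basis i y : (i < n)%N ->
  br (F2_basis K n i.+1) y = y 0 0 *: mul i.+1 1 + y 0 1 *: mul i.+1 2.
Proof.
move=> im; rewrite F2_br_expandr big_ord_recl big_ord_recl /= !F2_br_basis //=.
rewrite big1 ?addr0 ?addrA; last first.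
  by move=> j _; rewrite F2_br_tailr ?scaler0 //; apply: F2_basis_tail.
by congr (_ *: _ + y _ _ *: _); apply/val_inj.
Qed.

Lemma br_mk a f c g :
  br (mk a f) (mk c g) =
  mk 0 (f * ((g`_0)%:P * 'X + c%:P * B) + (a * c * gamma)%:P * 'X^(m.+2)).
Proof.
rewrite F2_br_expandl big_ord_recl big_ord_recl !br_basis ?ltn_ord // !mxE.
set G := _%:P * 'X + _.
under eq_bigr => i _.
  rewrite br_basis ?ltn_ord // !mxE /= mul_1 mul_2 !mkZ mkD !mulr0 addr0 mkZ mulr0.
  rewrite (_ : _ *: (_ + _) = (f`_i.+1 *: 'X^(i.+1)) * G); last first.
    by rewrite /G -!mul_polyC; ring.
  over.
rewrite mk_sum -mulr_suml /=.
have -> : mul 1 1 = mk 0 'X by rewrite /F2_mul /= basis_mk // expr1.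
have -> : mul 1 2 = mk 0 B.
  rewrite /F2_mul /= sum_basis_mk //; apply/mk_modX/modX_coefP => i im.
  by rewrite coef_sum_Xn // coef_poly im.
have -> : mul 2 1 = 0 by [].
have -> : mul 2 2 = mk 0 (gamma *: 'X^(m.+2)).
  by rewrite /F2_mul /= basis_mk // mkZ mulr0; congr (mk _ (_ *: 'X^_)); lia.
rewrite scaler0 add0r !mkZ !mkD !mkZ !mkD !(mulr0, addr0).
apply/mk_modX.
(* The sum over coordinates recovers f only modulo X^(m+3), which is all that [mk] sees. *)
have [h def_f] : modX m.+3 f (f`_0 *: 1 + \sum_(i < m.+2) f`_i.+1 *: 'X^(i.+1)).
  apply/modX_coefP => i im; rewrite -(expr0 'X).
  rewrite -(big_ord_recl m.+2 (fun i => f`_i *: 'X^i)) -poly_def.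
  by rewrite coef_poly im.
exists (- h * G); rewrite {3}def_f /G -!mul_polyC !polyCM; ring.
Qed.

End PolyModel.

(** * Linear isomorphisms and transport of strong nilpotency *)

Section Isomorphisms.
Variable K : fieldType.

Lemma linear_lfun (V W : vectType K) (f : V -> W) :
  linear f -> exists h : 'Hom(V, W), h =1 f.
Proof.
move=> lin_f; pose F : {linear V -> W} :=
  HB.pack f (GRing.isLinear.Build K V W *:%R f lin_f).
by exists (linfun F) => x; rewrite lfunE.
Qed.

Lemma injective_lfun_bij (V W : vectType K) (f : 'Hom(V, W)) :
  \dim {:V} = \dim {:W} -> (forall x, f x = 0 -> x = 0) -> bijective f.
Proof.
move=> dimVW f0; have ker0 : lker f == 0%VS.
  by rewrite -subv0; apply/subvP => x; rewrite memv_ker memv0 => /eqP/f0 ->.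
have imf : limg f = fullv.
  apply/eqP; rewrite eqEdim subvf /= limg_dim_eq ?dimVW //.
  by rewrite (eqP ker0) capv0.
exists (f^-1)%VF; first exact: lker0_lfunK.
by move=> y; rewrite limg_lfunVK // imf memvf.
Qed.

Lemma leibniz_isomorphic_sym (L M : leibnizType K) :
  leibniz_isomorphic L M -> leibniz_isomorphic M L.
Proof.
case=> f [[g fK gK] fM].
have lin_g : linear g by move=> a x y; rewrite -{1}[x]gK -{1}[y]gK -linearP fK.
have [h hg] := linear_lfun lin_g; exists h; split=> [|x y].
  by exists f => x; rewrite hg.
by rewrite !hg -{1}[x]gK -{1}[y]gK -fM fK.
Qed.

Lemma leibniz_isomorphic_trans (L M N : leibnizType K) :
  leibniz_isomorphic L M -> leibniz_isomorphic M N -> leibniz_isomorphic L N.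
Proof.
case=> f [bij_f fM] [g [bij_g gM]]; exists (g \o f)%VF; split=> [|x y].
  by apply: (eq_bij (bij_comp bij_g bij_f)) => x; rewrite lfunE.
by rewrite !lfunE /= fM gM.
Qed.

(** Conjugation by the isomorphism turns a pre-derivation of L into one of M and commutes with
    taking iterates. *)
Lemma strongly_nilpotent_iso (L M : leibnizType K) :
  leibniz_isomorphic L M -> strongly_nilpotent M -> strongly_nilpotent L.
Proof.
case=> f [[g fK gK] fM] nilM P derP.
have lin_Q : linear (fun y => f (P (g y))).
  move=> a x y; rewrite (_ : g _ = a *: g x + g y) ?linearP //.
  by rewrite -{1}[x]gK -{1}[y]gK -linearP fK.
have [Q defQ] := linear_lfun lin_Q.
have [x y z|k Qk] := nilM Q.
  rewrite -[x]gK -[y]gK -[z]gK !defQ !fK -!fM !fK derP.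
  by rewrite !linearD.
exists k => x; apply: (can_inj fK); rewrite linear0 -(Qk (f x)).
by elim: k {Qk} => //= k <-; rewrite defQ fK.
Qed.

End Isomorphisms.

(** * Replacing the generators e_1 and e_2 *)

Section ChangeOfBasis.
Variables (K : numFieldType) (m : nat) (n4 : (4 <= m.+4)%N).
Variables (beta beta' : nat -> K) (gamma c d : K).
Notation B := (beta_poly m beta).
Notation B' := (beta_poly m beta').

Lemma beta_poly_X2 b : exists B1, beta_poly (K := K) m b = 'X^2 * B1.
Proof.
have [h] : modX 2 (beta_poly m b) 0.
  by apply/modX_coefP => -[|[|i]] // _; rewrite coef_poly coef0.
by rewrite add0r => e; exists h.
Qed.

Let xt := 'X + c%:P * B.

Let xt_mul : exists2 v : {poly K}, xt = 'X * v & v`_0 = 1.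
Proof.
have [B1 defB] := beta_poly_X2 beta.
exists (1 + c%:P * 'X * B1); first by rewrite /xt defB; ring.
by rewrite coefD coef1 -mulrA coefCM coefXM mulr0 addr0.
Qed.

(* e_1 |-> e_1 + c e_2 and e_2 |-> d e_2 - d c gamma e_(n-1), where the last term
   is there to keep [e_2, e_1] = 0; the image of e_3 is then [e_1, e_1] =
   X + c B + c^2 gamma X^(n-2). *)
Definition base_change (v : 'rV[K]_m.+4) : 'rV[K]_m.+4 :=
  let: a := coef2 v in let: f := polyp v in
  mk m (d * a + c * f`_0)
    (f \Po xt - (a * d * c * gamma)%:P * 'X^(m.+1)
     + (c ^+ 2 * gamma * f`_1)%:P * 'X^(m.+2)).

Lemma base_change_mk a f : base_change (mk m a f) =
  mk m (d * a + c * f`_0)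
    (f \Po xt - (a * d * c * gamma)%:P * 'X^(m.+1)
     + (c ^+ 2 * gamma * f`_1)%:P * 'X^(m.+2)).
Proof.
rewrite /base_change coef2_mk !coef_polyp_mk //; apply: mk_modX.
have [v -> _] := xt_mul; have [h ->] := modX_comp v (polyp_mk m a f).
by exists h; ring.
Qed.

Lemma base_change_linear : linear base_change.
Proof.
move=> k x y; rewrite -(mkK x) -(mkK y) mk_lin !base_change_mk mk_lin.
rewrite !coefD !coefZ comp_polyD comp_polyZ.
congr mk; first by ring.
rewrite -!mul_polyC !(polyCM, polyCD); ring.
Qed.

Lemma base_change_inj : d != 0 -> forall x, base_change x = 0 -> x = 0.
Proof.
move=> d0 x; rewrite -(mkK x); move: (coef2 x) (polyp x) => a f.
rewrite base_change_mk -mk0 => /mk_inj[].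
have [v -> v0] := xt_mul => e /[dup] /modX_coefP fx.
(* The scalars f_0, a and f_1 are shown to vanish in this order; each removes one extra term of
   [base_change]. *)
have f0 : f`_0 = 0.
  move: (fx 0 isT); rewrite !coefD coefN !coefCM !coefXn !mulr0 subr0 addr0.
  by rewrite coef0_comp coef0.
move: e; rewrite f0 mulr0 addr0 => /eqP; rewrite mulf_eq0 (negPf d0) /= => /eqP a0.
rewrite a0 !mul0r subr0 => fm.
have f1 : f`_1 = 0.
  have /modX_coefP -> // : modX 2 f 0; last by rewrite coef0.
  apply: (modX_comp_inj v0); case: fm => h e.
  exists ('X^m * ('X * h - (c ^+ 2 * gamma * f`_1)%:P)).
  by rewrite -[LHS](addrK ((c ^+ 2 * gamma * f`_1)%:P * 'X^(m.+2))) e !exprS; ring.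
move: fm; rewrite f1 mulr0 mul0r addr0 => fm.
exact/mk_modX/(modX_comp_inj v0).
Qed.

(** This equates the image of [e_1, e_2] with the bracket of the images. The term in X^(m+2) is
    [c e_2, d e_2]. *)
Hypothesis B'_comp :
  modX m.+3 (B' \Po xt) (d%:P * B + (d * c * gamma)%:P * 'X^(m.+2)).

Lemma base_change_br x y :
  base_change (F2_br beta' (d ^+ 2 * gamma) x y) =
  F2_br beta gamma (base_change x) (base_change y).
Proof.
rewrite -(mkK x) -(mkK y).
move: (coef2 x) (polyp x) (coef2 y) (polyp y) => a f b g.
rewrite br_mk !base_change_mk br_mk.
have [v def_xt v0] := xt_mul.
have [B1 defB] := beta_poly_X2 beta; have [B1' defB'] := beta_poly_X2 beta'.
set h := f * _ + _.
have h0 : h`_0 = 0.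
  rewrite /h defB' coefD coef0M coefD !coefCM coefXnM !coefX coefXn.
  by rewrite /= !(mulr0, addr0).
have h1 : h`_1 = f`_0 * g`_0.
  rewrite /h defB' coefD coefCM coefXn mulr0 addr0 coefM big_ord_recl big_ord1 /=.
  rewrite !coefD !coefCM !coefXnM !coefX /= !mulr0 !addr0 mulr1.
  by rewrite mulr0 addr0.
have -> : (g \Po xt - (b * d * c * gamma)%:P * 'X^(m.+1)
     + (c ^+ 2 * gamma * g`_1)%:P * 'X^(m.+2))`_0 = g`_0.
  by rewrite def_xt !coefD coefN !coefCM !coefXn !mulr0 subr0 addr0 coef0_comp.
rewrite h0 h1 !mulr0 addr0; apply: mk_modX.
rewrite /h comp_polyD 2!comp_polyM comp_Xn_poly comp_polyD !comp_polyM.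
rewrite !comp_polyC comp_polyX.
have [h' ->] := B'_comp.
have [f'] := modX1 (f \Po xt); rewrite {2}def_xt coef0_comp => def_f.
have [k] := modX1 (v ^+ m.+2).
rewrite -horner_coef0 horner_exp horner_coef0 v0 expr1n => def_v.
have -> : xt ^+ m.+2 = 'X^(m.+2) * (1 + 'X * k) by rewrite def_xt exprMn def_v polyC1 expr1.
exists (f' * (b * d * c * gamma)%:P + (f \Po xt) * b%:P * h'
  + (a * b * d ^+ 2 * gamma)%:P * k
  + (a * d * c * gamma)%:P * (d * b + c * g`_0)%:P * B1
  - (c ^+ 2 * gamma * f`_1)%:P * ((g`_0)%:P + (d * b + c * g`_0)%:P * 'X * B1)).
rewrite def_f /xt defB !exprS !(polyCM, polyCD) !expr0; ring.
Qed.

Lemma F2_base_change : d != 0 ->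
  leibniz_isomorphic (F2 n4 beta' (d ^+ 2 * gamma)) (F2 n4 beta gamma).
Proof.
move=> d0; have [h hE] := @linear_lfun K (F2 n4 beta' (d ^+ 2 * gamma))
  (F2 n4 beta gamma) base_change base_change_linear.
exists h; split=> [|x y]; last by rewrite !hE; apply: base_change_br.
apply: injective_lfun_bij => [|x]; first by rewrite !F2_dim.
by rewrite hE; apply: base_change_inj.
Qed.

End ChangeOfBasis.

(** * Structure of the pre-derivations *)

Section Prederivations.
Variables (K : numFieldType) (m : nat) (beta : nat -> K) (gamma : K).
Notation B := (beta_poly m beta).
Notation br := (F2_br beta gamma).
Notation "f ≡ g" := (modX m.+3 f g) (at level 70).

Definition rmul (v : 'rV[K]_m.+4) : {poly K} :=
  ((polyp v)`_0)%:P * 'X + (coef2 v)%:P * B.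

Lemma polyp_lin k (x y : 'rV[K]_m.+4) : polyp (k *: x + y) = k *: polyp x + polyp y.
Proof.
apply/polyP => i; rewrite coefD coefZ !coef_poly.
by case: ifP => _; rewrite ?mxE // mulr0 addr0.
Qed.

Lemma rmul_X v : exists h, rmul v = 'X * h.
Proof.
have [B1 defB] := beta_poly_X2 m beta.
by exists (((polyp v)`_0)%:P + (coef2 v)%:P * 'X * B1); rewrite /rmul defB; ring.
Qed.

Lemma br_rmul v w : exists e, br v w = mk m 0 (polyp v * rmul w + e%:P * 'X^(m.+2)).
Proof.
exists (coef2 v * coef2 w * gamma).
by rewrite -{1}(mkK v) -{1}(mkK w) br_mk /rmul.
Qed.

(** The gamma term of the inner bracket sits in top degree m+2 and [rmul z] is divisible by X, so
    triple products do not see gamma. *)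
Lemma br_br_rmul v w z : br (br v w) z = mk m 0 (polyp v * rmul w * rmul z).
Proof.
have [e ->] := br_rmul v w; rewrite -{1}(mkK z) br_mk -/(rmul z) !mul0r addr0.
apply: mk_modX; have [h ->] := rmul_X z.
by exists (e%:P * h); rewrite !exprS; ring.
Qed.

Variable P : {linear 'rV[K]_m.+4 -> 'rV[K]_m.+4}.
Hypothesis derP : forall x y z,
  P (br (br x y) z) = br (br (P x) y) z + br (br x (P y)) z + br (br x y) (P z).

Let Q f := polyp (P (mk m 0 f)).

Let Q_lin k f g : Q (k *: f + g) = k *: Q f + Q g.
Proof. by rewrite -polyp_lin -linearP mk_lin mulr0 addr0. Qed.

Let Q_der f w z :
  Q (f * rmul w * rmul z) ≡
  Q f * rmul w * rmul z + f * rmul (P w) * rmul z + f * rmul w * rmul (P z).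
Proof.
have [h e] := polyp_mk m 0 f.
have := derP (mk m 0 f) w z; rewrite !br_br_rmul !mkD !addr0.
have -> : mk m 0 (polyp (mk m 0 f) * rmul w * rmul z) = mk m 0 (f * rmul w * rmul z).
  by apply: mk_modX; rewrite e; exists (h * rmul w * rmul z); ring.
rewrite /Q => ->.
have [k ->] := polyp_mk m 0 (polyp (P (mk m 0 f)) * rmul w * rmul z
  + polyp (mk m 0 f) * rmul (P w) * rmul z + polyp (mk m 0 f) * rmul w * rmul (P z)).
rewrite e; exists (k + h * rmul (P w) * rmul z + h * rmul w * rmul (P z)); ring.
Qed.

Let e1 := mk m 0 (1 : {poly K}).
Let e2 : 'rV[K]_m.+4 := mk m 1 0.

Let rmul_e1 : rmul e1 = 'X.
Proof. by rewrite /rmul coef_polyp_mk // coef2_mk coef1 mul0r addr0 mul1r. Qed.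

Let rmul_e2 : rmul e2 = B.
Proof. by rewrite /rmul coef_polyp_mk // coef2_mk coef0 mul0r add0r mul1r. Qed.

Let p := (polyp (P e1))`_0.
Let c := coef2 (P e1).
Let r := (polyp (P e2))`_0.
Let q := coef2 (P e2).
Let u := Q 1.
Let X' := rmul (P e1).

(* The deviation of P from the first-order operator f |-> f' X' + f u; it is
   linear over the polynomials in X^2, hence determined by its value at X. *)
Let D f := Q f - f^`() * X' - f * u.

Let D_lin k f g : D (k *: f + g) = k *: D f + D g.
Proof. by rewrite /D Q_lin derivD derivZ -!mul_polyC; ring. Qed.

(** Multiplying twice by e_1 gives Q(X^2 f) = X^2 Q f + 2 X X' f; the last term is cancelled by the
    derivative of X^2 inside D. *)
Let D_X2 f : D ('X^2 * f) ≡ 'X^2 * D f.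
Proof.
have [h] := Q_der f e1 e1; rewrite rmul_e1 -/X' => e; exists h.
rewrite /D derivM derivXn /= (_ : 'X^2 * f = f * 'X * 'X) ?e; ring.
Qed.

Let D_even f g : D ((f \Po 'X^2) * g) ≡ (f \Po 'X^2) * D g.
Proof.
elim/poly_ind: f => [|f a [h IH]].
  rewrite comp_poly0 !mul0r; exists 0.
  by move: (D_lin (-1) 0 0); rewrite scaler0 addr0 scaleN1r addNr mulr0 addr0.
have [h2 e] := D_X2 ((f \Po 'X^2) * g).
rewrite comp_polyD comp_polyM comp_polyX comp_polyC.
rewrite (_ : (_ + a%:P) * g = a *: g + 'X^2 * ((f \Po 'X^2) * g)); last first.
  by rewrite -mul_polyC; ring.
exists ('X^2 * h + h2); rewrite D_lin e IH -mul_polyC; ring.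
Qed.

Let w := D 'X.

Let D1 : D 1 = 0.
Proof. by rewrite /D derivC mul0r subr0 mul1r subrr. Qed.

Let D_even_odd f : D f ≡ (odd_poly f \Po 'X^2) * w.
Proof.
have [h e] := D_even (even_poly f) 1; have [k e'] := D_even (odd_poly f) 'X.
rewrite D1 mulr0 add0r in e.
exists (h + k); rewrite -{1}(poly_even_odd f) -[X in D (X + _)]mulr1 -[X in D (X + _)]scale1r.
rewrite D_lin scale1r e e' -/w; ring.
Qed.

(** X times the amount by which the vector field X' d/dX fails to send B to r X + q B. *)
Let E := 'X * (r%:P * 'X + q%:P * B) - 'X * B^`() * X'.

Let D_XB f : D ('X * B * f) ≡ 'X * B * D f + E * f.
Proof.
have [h] := Q_der f e1 e2; rewrite rmul_e1 rmul_e2 -/X' => e; exists h.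
rewrite /D !derivM derivX (_ : 'X * B * f = f * 'X * B) ?e /E /rmul -/r -/q; ring.
Qed.

Let b0 := even_poly B \Po 'X^2.

(** Evaluate [D_XB] twice, modulo X^(m+3). At f = 1, E = D(XB) = b0 w. At f = X, XBw + XE = D(X^2 B)
    = X^2 b1 w. With B = b0 + b1 X this leaves 2 X b0 w = 0, hence X E = 0. *)
Let XE_b0w : 'X * b0 * w ≡ 0 /\ 'X * E ≡ 0.
Proof.
set b1 := odd_poly B \Po 'X^2.
have [h1] := D_XB 1; rewrite D1 mulr0 add0r !mulr1 => eq1.
have [h2 eq2] := D_XB 'X; rewrite -/w in eq2.
have [h3 eq3] := D_X2 B.
have [h4] := D_even_odd B; rewrite -/b1 => eq4.
have [h5] := D_even_odd ('X * B).
have -> : odd_poly ('X * B) = even_poly B by rewrite mulrC odd_polyMX.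
rewrite -/b0 => eq5.
have defB : B = b0 + b1 * 'X by rewrite /b0 /b1 poly_even_odd.
have eqE : E = b0 * w + 'X^(m.+3) * (h5 - h1).
  have -> : E = D ('X * B) - 'X^(m.+3) * h1 by rewrite eq1 addrK.
  by rewrite eq5; ring.
have eqb : 2%:R * ('X * b0 * w) = 'X^(m.+3) * ('X^2 * h4 + h3 - h2 - 'X * (h5 - h1)).
  have : 'X * B * w + E * 'X + 'X^(m.+3) * h2 = 'X^2 * (b1 * w + 'X^(m.+3) * h4) + 'X^(m.+3) * h3.
    by rewrite -eq2 -eq4 -eq3; congr D; ring.
  rewrite eqE defB => /eqP; rewrite -subr_eq0 => /eqP e.
  by apply/eqP; rewrite -subr_eq0 -e; apply/eqP; ring.
have b0w : 'X * b0 * w ≡ 0.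
  have two : (2%:R^-1)%:P * 2%:R = 1 :> {poly K}.
    by rewrite -polyC_natr -polyCM mulVf // pnatr_eq0.
  exists ((2%:R^-1)%:P * ('X^2 * h4 + h3 - h2 - 'X * (h5 - h1))).
  rewrite add0r; transitivity ((2%:R^-1)%:P * (2%:R * ('X * b0 * w))).
    by rewrite (mulrA (2%:R^-1)%:P) two mul1r.
  by rewrite eqb; ring.
split=> //; case: b0w => h; rewrite add0r => b0w.
exists (h + 'X * (h5 - h1)); rewrite add0r.
have -> : 'X * E = 'X * b0 * w + 'X^(m.+3) * ('X * (h5 - h1)) by rewrite eqE; ring.
by rewrite b0w; ring.
Qed.

Variables (k : nat).
Hypotheses (k_le : (k <= m)%N) (Bk : B`_k != 0).

Let B01 i : (i < 2)%N -> B`_i = 0.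
Proof. by case: i => [|[|]] // _; rewrite coef_poly. Qed.

Let k_ge2 : (2 <= k)%N.
Proof. by rewrite leqNgt; apply/negP => /B01/eqP; apply/negP. Qed.

Lemma prederivation_symbol : modX m.+1 (B^`() * X') (r%:P * 'X + q%:P * B).
Proof.
have [_ [h]] := XE_b0w; rewrite add0r /E => e.
apply: (@modX_cancel K m.+1 2); exists (- h).
by rewrite -[(2 + m.+1)%N]/(m.+3) mulrN -e; ring.
Qed.

(** Right multiplication by y = [mk m 0 f] is zero, so the identity for e_1, y, e_1 reduces to X
    [rmul (P y)] = 0. The coefficients 1 and k of [rmul (P y)] isolate the e_1 and e_2 coordinates
    of P y. *)
Lemma prederivation_tail (f : {poly K}) : f`_0 = 0 ->
  coef2 (P (mk m 0 f)) = 0 /\ (Q f)`_0 = 0.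
Proof.
move=> f0; set y := mk m 0 f.
have [h] := Q_der 1 y e1.
have -> : rmul y = 0 by rewrite /rmul coef2_mk coef_polyp_mk // f0 !mul0r addr0.
rewrite rmul_e1 !(mulr0, mul0r, mul1r, add0r, addr0).
have -> : Q 0 = 0 by rewrite /Q mk0 linear0; apply/polyP => i; rewrite coef_poly coef0 mxE if_same.
move=> eq0.
have /modX_coefP Y : modX m.+2 (rmul (P y)) 0.
  apply: (@modX_cancel _ _ 1); exists (- h).
  by rewrite mulr0 add0r mulrN expr1 [LHS]mulrC; apply/eqP; rewrite -addr_eq0 -eq0.
have y1 : (Q f)`_0 = 0.
  by have := Y 1 isT; rewrite coefD !coefCM coefX B01 // mulr1 mulr0 addr0 coef0.
split=> //; have := Y k; rewrite coefD !coefCM coefX -/y.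
rewrite (_ : (polyp (P y))`_0 = 0) // mul0r add0r coef0 ltnS => /(_ (leqW k_le)) /eqP.
by rewrite mulf_eq0 (negPf Bk) orbF => /eqP.
Qed.

Let w0 : p = 0 -> w`_0 = 0.
Proof.
move=> p0; have [v vX] := rmul_X (P e1); rewrite -/X' in vX.
rewrite /w /D derivX mul1r vX !coefB !coefXM /= !subr0.
by case: (@prederivation_tail 'X); rewrite ?coefX.
Qed.

(** Here w is X times a polynomial with nonzero constant term, which can be cancelled from X b0 w =
    0 along with X^2. *)
Lemma prederivation_even_part i : p = 0 -> w`_1 != 0 -> ~~ odd i -> (i <= m)%N -> B`_i = 0.
Proof.
move=> p0 w1 i_even im; have [[h b0w] _] := XE_b0w.
have [w'] : modX 1 w 0 by apply/modX_coefP => -[|j] // _; rewrite w0 // coef0.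
rewrite add0r expr1 => def_w; rewrite def_w coefXM /= in w1.
have b00 : modX m.+1 b0 0.
  apply: (modX_mulr_inj w1); apply: (@modX_cancel _ _ 2); exists h.
  rewrite mulr0 add2n -b0w def_w; ring.
move/modX_coefP/(_ i im): b00; rewrite /b0 coef_comp_poly_Xn // dvdn2 i_even.
by rewrite coef_even_poly coef0 -muln2 divnK // dvdn2.
Qed.

(** Q F = D F + F' X' + F u, and each summand gains a degree: X^2 divides X' and w, and X divides
    u. *)
Let P_step j f : p = 0 -> w`_1 = 0 ->
  exists h, P (mk m 0 ('X^(j.+1) * f)) = mk m 0 ('X^(j.+2) * h).
Proof.
move=> p0 w1; set F := 'X^(j.+1) * f.
have F0 : F`_0 = 0 by rewrite /F coefXnM.
have [cF _] := prederivation_tail F0.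
suff [h hF] : exists h, Q F ≡ 'X^(j.+2) * h.
  exists h; rewrite -[LHS]mkK cF; exact: mk_modX.
have [w'] : modX 2 w 0 by apply/modX_coefP => -[|[|i]] // _; rewrite ?w0 ?w1 ?coef0.
rewrite add0r => def_w.
have [u'] : modX 1 u 0 by apply/modX_coefP => -[|i] // _; rewrite -/p p0 coef0.
rewrite add0r expr1 => def_u.
have [v defX'] : exists v, X' = 'X^2 * v.
  have [B1 defB] := beta_poly_X2 m beta.
  by exists (c%:P * B1); rewrite /X' /rmul -/p -/c p0 defB polyC0; ring.
have [H [k1 eqD]] : exists H, D F ≡ 'X^(j.+2) * H.
  (* Pulling t factors X^2 out of X^(j+1) makes D F a multiple of X^(2t) w, of order at least 2t + 2
     >= j + 2. *)
  pose t := j.+1./2.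
  have defF : F = ('X^t \Po 'X^2) * ('X^(odd j.+1) * f).
    rewrite comp_Xn_poly -exprM mulrA -exprD /F; congr ('X^_ * _).
    by rewrite addnC mul2n odd_double_half.
  rewrite defF; have [h1 ->] := D_even 'X^t ('X^(odd j.+1) * f).
  have [h2 ->] := D_even_odd ('X^(odd j.+1) * f).
  set O := odd_poly _ \Po _; rewrite def_w comp_Xn_poly -exprM.
  have le_j : (j.+2 <= 2 * t + 2)%N by rewrite /t; lia.
  exists ('X^(2 * t + 2 - j.+2) * (O * w')); exists (h1 + 'X^(2 * t) * h2).
  rewrite (mulrA 'X^(j.+2)) -exprD subnKC // exprD; ring.
rewrite (_ : Q F = D F + F^`() * X' + F * u); last by rewrite /D; ring.
exists (H + (j.+1%:R * f + 'X * f^`()) * v + f * u'); exists k1.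
rewrite eqD /F derivM derivXn /= -mulr_natl defX' def_u.
rewrite !exprS; ring.
Qed.

Lemma prederivation_nilpotent : p = 0 -> q = 0 -> r = 0 -> w`_1 = 0 ->
  iter m.+4 P =1 fun=> 0.
Proof.
move=> p0 q0 r0 w1 v.
have P1 x : exists h, P x = mk m ((polyp x)`_0 * c) ('X * h).
  have [f def_f] := modX1 (polyp x).
  have [cf f0] : coef2 (P (mk m 0 ('X * f))) = 0 /\ (Q ('X * f))`_0 = 0.
    by apply: prederivation_tail; rewrite coefXM.
  have Px : P x = coef2 x *: P e2 + ((polyp x)`_0 *: P e1 + P (mk m 0 ('X * f))).
    rewrite -!linearZ -!linearD; congr (P _).
    rewrite !mkZ !mkD -{1}[x]mkK -!mul_polyC !mulr0 !mulr1 !addr0 add0r.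
    by rewrite {1}def_f expr1.
  have Px2 : coef2 (P x) = (polyp x)`_0 * c.
    rewrite Px /coef2 !mxE -!/(coef2 _) cf -/q q0 -/c; ring.
  have [h def_h] := modX1 (polyp (P x)).
  exists h; rewrite -[LHS]mkK Px2 def_h Px !polyp_lin !coefD !coefZ -/r -/p.
  by rewrite r0 p0 (f0 : (polyp (P (mk m 0 ('X * f))))`_0 = 0) !mulr0 !addr0 polyC0 add0r expr1.
have iterP j f : exists h, iter j P (mk m 0 ('X * f)) = mk m 0 ('X^(j.+1) * h).
  elim: j => [|j [h e]]; first by exists f.
  by rewrite iterS e; apply: P_step.
have [h1 eq1] := P1 v; have [h2] := P1 (P v).
rewrite {2}eq1 coef_polyp_mk // coefXM mul0r => eq2.
(* Two applications of P bring any vector into X K[X]; m+2 more push it past the top degree m+2. *)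
rewrite 2!iterSr eq2; have [h ->] := iterP m.+2 h2.
by rewrite -mk0; apply: mk_modX; exists h; rewrite add0r.
Qed.

(** If p is nonzero, [prederivation_symbol] gives the third case; otherwise q = r = 0 and w_1
    decides between the first two. *)
Lemma prederivation_dichotomy :
  (forall i, (i < k)%N -> B`_i = 0) ->
  [\/ iter m.+4 P =1 fun=> 0,
     forall i, ~~ odd i -> (i <= m)%N -> B`_i = 0
   | exists2 a : K, a != 0 & exists b : K,
       modX m.+1 (B^`() * (a%:P * 'X + b%:P * B)) ((a * k%:R)%:P * B)].
Proof.
move=> k_min; have sym := prederivation_symbol; rewrite /X' /rmul -/p -/c in sym.
have [B1 defB] := beta_poly_X2 m beta.
(* r is the coefficient of X in the symbol relation, whose left side has order at least 2. *)
have r0 : r = 0.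
  move/modX_coefP/(_ 1%N): sym; rewrite ltnS (leq_trans _ k_le) ?(leq_trans _ k_ge2) //.
  move=> /(_ isT); rewrite coefD !coefCM coefX B01 // mulr0 addr0 mulr1 => <-.
  rewrite (_ : _ * _ = 'X^2 * ((2%:R * B1 + 'X * B1^`()) * (p%:P + c%:P * 'X * B1))).
    by rewrite coefXnM.
  rewrite defB derivM derivXn /= -mulr_natl; ring.
(* Compare coefficients at X^k, the lowest degree of B, where B' X' has coefficient p k B_k. *)
have qE : q = p * k%:R.
  have [b] : modX k B 0 by apply/modX_coefP => i /k_min ->; rewrite coef0.
  rewrite add0r => defB'.
  have b0N : b`_0 != 0 by move: Bk; rewrite defB' coefXnM ltnn subnn.
  move/modX_coefP/(_ k): sym; rewrite ltnS k_le => /(_ isT).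
  rewrite r0 polyC0 mul0r add0r coefCM.
  have -> : B^`() * (p%:P * 'X + c%:P * B) =
      'X^k * ((k%:R * b + 'X * b^`()) * (p%:P + c%:P * 'X * B1)).
    rewrite {2}defB (_ : p%:P * 'X + _ = 'X * (p%:P + c%:P * 'X * B1)); last by ring.
    rewrite (mulrA 'X^k) (mulrA B^`()); congr (_ * _); rewrite defB' derivM derivXn -mulr_natl.
    by case: k k_ge2 => // k' _; rewrite /= exprS; ring.
  rewrite defB' !coefXnM ltnn subnn coef0M !coefD coef0M -polyC_natr coefC coefXM /=.
  rewrite -mulrA coefCM coefC coefXM mulr0 !addr0 (mulrC k%:R) -mulrA (mulrC b`_0).
  by move/(mulIf b0N) => <-; rewrite mulrC.
have [p0|p0] := eqVneq p 0; last first.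
  by constructor 3; exists p => //; exists c; move: sym; rewrite r0 polyC0 mul0r add0r qE.
have [w1|w1] := eqVneq w`_1 0; last first.
  by constructor 2 => i; apply: prederivation_even_part.
by constructor 1; apply: prederivation_nilpotent; rewrite // qE p0 mul0r.
Qed.

End Prederivations.

(** * The linearizing coordinate and the normal form *)

Section NormalForm.
Variables (K : numFieldType) (m : nat) (n4 : (4 <= m.+4)%N).
Variables (beta : nat -> K) (gamma a b : K) (k : nat).
Notation B := (beta_poly m beta).
Hypotheses (k_le : (k <= m)%N) (Bk : B`_k != 0) (a0 : a != 0).
Hypothesis symB :
  modX m.+1 (B^`() * (a%:P * 'X + b%:P * B)) ((a * k%:R)%:P * B).

(* The coordinate X + t B is an eigenvector of the derivation (aX + bB) d/dX,
   for the eigenvalue a; B is an eigenvector for ak, so it is a multiple of the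
   k-th power of that coordinate. *)
Lemma F2_normal_form : exists (beta' : nat -> K) (gamma' : K),
  [/\ beta' k.+2 = 1,
      forall j, (4 <= j <= m.+2)%N -> j <> k.+2 -> beta' j = 0
    & leibniz_isomorphic (F2 n4 beta' gamma') (F2 n4 beta gamma)].
Proof.
have k_ge2 : (2 <= k)%N.
  by case: k Bk => [|[|]] //; rewrite coef_poly eqxx.
have ak : a - a * k%:R != 0.
  rewrite -{1}[a]mulr1 -mulrBr mulf_neq0 // subr_eq0 eq_sym pnatr_eq1.
  by case: k k_ge2 => [|[|]].
(* The equation says that the vector field maps X + t B to aX + (b + t a k) B = a (X + t B); it is
   solvable because k differs from 1. *)
have [t tE] : exists t, b + t * (a * k%:R) = t * a.
  by exists (b / (a - a * k%:R)); field.
have [B1 defB] := beta_poly_X2 m beta.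
pose v : {poly K} := 1 + t%:P * 'X * B1.
have v0 : v`_0 = 1 by rewrite coefD coef1 -mulrA coefCM coefXM mulr0 addr0.
have xtE : 'X * v = 'X + t%:P * B by rewrite /v defB; ring.
(* g expresses B, with the gamma term required by [F2_base_change], in the new coordinate. *)
have [g gB] := modX_comp_surj m.+3 (B + (t * gamma)%:P * 'X^(m.+2)) v0.
have [h1 gB1] : modX m.+1 (g \Po ('X * v)) B.
  case: gB => h ->; exists ((t * gamma)%:P * 'X + 'X^2 * h); rewrite !exprS; ring.
have [h2 symB'] := symB.
(* Chain rule; the factor X restores the degree of precision lost by differentiating X^(m+1) h1. *)
have [h3 dgB] : modX m.+1 ((g^`() \Po ('X * v)) * (1 + t%:P * B^`()) * 'X) (B^`() * 'X).
  exists (m.+1%:R * h1 + 'X * h1^`()).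
  have := congr1 (fun f : {poly K} => f^`()) gB1.
  rewrite deriv_comp xtE derivD derivM derivXn -mulr_natl /=.
  rewrite (derivD 'X) derivX (derivM t%:P) derivC mul0r add0r => ->.
  by rewrite exprS; ring.
have eqX : 'X * (a%:P + b%:P * 'X * B1) = a%:P * 'X + b%:P * B by rewrite defB; ring.
(* In the new coordinate the vector field is a X d/dX, so its eigenvectors are monomials up to
   degree m. *)
have g_eigen : modX m.+1 (a%:P * 'X * g^`() - (a * k%:R)%:P * g) 0.
  apply: (modX_comp_inj v0); rewrite comp_polyB !comp_polyM !comp_polyC comp_polyX.
  exists (h3 * (a%:P + b%:P * 'X * B1) + h2 - (a * k%:R)%:P * h1
          - t%:P * h2 * (g^`() \Po ('X * v))).
  rewrite add0r gB1.
  have -> : a%:P * ('X * v) * (g^`() \Po ('X * v)) =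
    (g^`() \Po ('X * v)) * (1 + t%:P * B^`()) * 'X * (a%:P + b%:P * 'X * B1)
    - 'X^(m.+1) * (t%:P * h2 * (g^`() \Po ('X * v))).
    have -> : 'X^(m.+1) * (t%:P * h2 * (g^`() \Po ('X * v))) =
        t%:P * (B^`() * (a%:P * 'X + b%:P * B) - (a * k%:R)%:P * B)
          * (g^`() \Po ('X * v)).
      by rewrite symB'; ring.
    rewrite (_ : a%:P * ('X * v) = a%:P * 'X + (t * a)%:P * B); last first.
      by rewrite xtE polyCM; ring.
    by rewrite -tE polyCD (polyCM t) -(mulrA (_ * (1 + _))) eqX; ring.
  rewrite dgB.
  have -> : (B^`() * 'X + 'X^(m.+1) * h3) * (a%:P + b%:P * 'X * B1) =
    B^`() * (a%:P * 'X + b%:P * B) + 'X^(m.+1) * (h3 * (a%:P + b%:P * 'X * B1)).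
    by rewrite -eqX; ring.
  by rewrite symB'; ring.
have g_coef j : (j <= m)%N -> j != k -> g`_j = 0.
  move=> jm jk; move/modX_coefP/(_ j): g_eigen; rewrite ltnS => /(_ jm).
  rewrite coefB -mulrA !coefCM coefXM coef_deriv coef0.
  have -> : (if j == 0%N then 0 else g`_j.-1.+1 *+ j.-1.+1) = j%:R * g`_j.
    by case: j {jm jk} => [|j] /=; rewrite ?mul0r // mulr_natl.
  rewrite mulrA -mulrBl => /eqP; rewrite mulf_eq0 -mulrBr mulf_eq0 (negPf a0) /=.
  by rewrite subr_eq0 eqr_nat (negPf jk) => /eqP.
have gk : g`_k != 0.
  apply: contra_neq Bk => gk0.
  have g0 : modX m.+1 g 0.
    apply/modX_coefP => j jm; rewrite coef0.
    by have [->|] := eqVneq j k; last exact: g_coef.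
  have := modX_comp v g0; rewrite comp_poly0 gB1 => /modX_coefP/(_ k).
  by rewrite ltnS k_le => /(_ isT); rewrite coefD coefXnM ltnS k_le addr0 coef0.
(* Scaling e_2 by d makes the parameter of index k+2 equal to 1. Degrees m+1 and m+2 of g stay free
   and give the parameters of index n-1 and n. *)
pose d := (g`_k)^-1; have d0 : d != 0 by rewrite invr_eq0.
pose beta' j := d * g`_(j - 2).
exists beta', (d ^+ 2 * gamma); split.
- by rewrite /beta' subn2 /= mulVf.
- by move=> j j_le jk; rewrite /beta' g_coef ?mulr0 //; [lia | apply/eqP; lia].
apply: (@F2_base_change K m n4 beta beta' gamma t d) => //; rewrite -xtE.
have [h beta'E] : modX m.+3 (beta_poly m beta') (d%:P * g).
  apply/modX_coefP => i im; rewrite coef_poly im coefCM /beta' subn2 /=.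
  by case: ifP => // /negbT i2; rewrite g_coef ?mulr0 //; lia.
have [h' e] := gB; rewrite beta'E comp_polyD (comp_polyM d%:P) comp_polyC e.
rewrite (comp_polyM 'X^_) comp_Xn_poly exprMn.
by exists (d%:P * h' + v ^+ m.+3 * (h \Po ('X * v))); rewrite !polyCM; ring.
Qed.

End NormalForm.

(** * Assembling the classification *)

Lemma F2_classification (K : numFieldType) (m : nat) (n4 : (4 <= m.+4)%N)
    (beta : nat -> K) (gamma : K) :
  ~ strongly_nilpotent (F2 n4 beta gamma) ->
  (forall j, ~~ odd j -> (4 <= j <= m.+2)%N -> beta j = 0) \/
  exists k (beta' : nat -> K) (gamma' : K),
    [/\ (2 <= k <= m)%N, beta' k.+2 = 1,
        forall j, (4 <= j <= m.+2)%N -> j <> k.+2 -> beta' j = 0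
      & leibniz_isomorphic (F2 n4 beta' gamma') (F2 n4 beta gamma)].
Proof.
set B := beta_poly m beta; move=> nsn.
have coefB i : (i <= m)%N -> B`_i = if (2 <= i)%N then beta i.+2 else 0.
  by move=> im; rewrite coef_poly ltnS (leq_trans im) // leqW.
have even_case : (forall i, ~~ odd i -> (i <= m)%N -> B`_i = 0) ->
    forall j, ~~ odd j -> (4 <= j <= m.+2)%N -> beta j = 0.
  move=> Beven [|[|j]] // j_even jm.
  have [j2 jm'] : (2 <= j)%N /\ (j <= m)%N by lia.
  have := Beven j; rewrite coefB // j2; apply=> //.
  by move: j_even; rewrite /= negbK.
have [Bm|] := pselect (forall i, (i <= m)%N -> B`_i = 0).
  by left; apply: even_case => i _; apply: Bm.
move=> /existsNP[i0 /not_implyP[i0m /eqP Bi0]].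
have exk : exists i, (i <= m)%N && (B`_i != 0) by exists i0; rewrite i0m.
(* k is the order of vanishing of B, as the dichotomy requires. *)
case: (ex_minnP exk) => k /andP[km Bk] k_min.
have B_lt i : (i < k)%N -> B`_i = 0.
  move=> ik; apply/eqP; apply: contraTT ik => Bi; rewrite -leqNgt.
  have [im|mi] := leqP i m; first by rewrite k_min // im.
  exact: leq_trans km (ltnW mi).
move/existsNP: nsn => [P /not_implyP[derP nnP]].
pose P' : {linear 'rV[K]_m.+4 -> 'rV[K]_m.+4} := P.
case: (@prederivation_dichotomy K m beta gamma P' derP k km Bk B_lt).
- by move=> nilP; case: nnP; exists m.+4.
- by move=> Beven; left; apply: even_case.
case=> a a0 [b symB]; right; exists k.
have [beta' [gamma' [b1 b0 iso]]] := F2_normal_form n4 gamma km Bk a0 symB.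
exists beta', gamma'; split=> //; rewrite km andbT.
by case: k Bk {km k_min B_lt symB b1 b0} => [|[|]] //; rewrite coef_poly eqxx.
Qed.

Theorem theorem4p5 (R : realType) (n : nat) (n4 : (4 <= n)%N)
    (n_even : ~~ odd n) (L : leibnizType R[i])
    (L_in_F2 : exists (beta : nat -> R[i]) (gamma : R[i]),
       leibniz_isomorphic L (F2 n4 beta gamma))
    (L_nsn : ~ strongly_nilpotent L) :
  (exists (s : nat) (beta : nat -> R[i]) (gamma : R[i]),
     [/\ (2 <= s <= (n - 2) %/ 2)%N,
         beta (2 * s)%N = 1,
         (forall j : nat, (4 <= j <= n - 2)%N -> j <> (2 * s)%N -> beta j = 0)
       & leibniz_isomorphic L (F2 n4 beta gamma)])
  \/
  (exists (beta : nat -> R[i]) (gamma : R[i]),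
     (forall i : nat, (2 <= i <= (n - 2) %/ 2)%N -> beta (2 * i)%N = 0)
     /\ leibniz_isomorphic L (F2 n4 beta gamma)).
Proof.
move: L_in_F2 => [beta [gamma isoL]].
case: n n4 n_even beta gamma isoL => [|[|[|[|m]]]] // n4 n_even beta gamma isoL.
have nsn : ~ strongly_nilpotent (F2 n4 beta gamma).
  by move/(strongly_nilpotent_iso isoL).
have [beta0|[k [beta' [gamma' [k_le b1 b0 iso]]]]] := F2_classification nsn.
  right; exists beta, gamma; split=> // i i_le.
  by apply: beta0; [rewrite oddM | lia].
have isoL' := leibniz_isomorphic_trans isoL (leibniz_isomorphic_sym iso).
(* For odd k the parameter equal to 1 has odd index k+2, so all even-indexed ones up to n-2 vanish;
   for even k, k+2 = 2s with s = k/2 + 1. *)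
have [k_odd|k_even] := boolP (odd k).
  right; exists beta', gamma'; split=> // i i_le.
  by apply: b0; lia.
left; exists (k./2.+1)%N, beta', gamma'.
have kE : (2 * k./2.+1)%N = k.+2 by lia.
by rewrite kE; split=> //; lia.
Qed.
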